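(* Let $K$ be a finite field, and let $\mathcal A$ be a sofic $K$-algebra, with rank function $\mathrm{rk}_{\mathcal A}$ derived from an injective unital homomorphism $\phi:\mathcal A\to\mathrm{Mat}^{\mathcal M}_\omega$. Let $R$ be a finite dimensional $K$-algebra, let $\rho:R\to\mathcal A$ be a unital homomorphism, and let $\mathrm{rk}_\rho\in\mathrm{Rank}(R)$ be the corresponding element of the rank spectrum, $\mathrm{rk}_\rho(A)=\mathrm{rk}_{\mathcal A}(\tilde\rho(A))$ for every finite rectangular matrix $A$ over $R$, where $\tilde\rho$ is $\rho$ applied entrywise. Then $\mathrm{rk}_\rho$ lies in the closure of $\mathrm{Fin}(R)$ in $\mathrm{Syl}(R)$.
   Context: Continuous ultraproduct: let $\omega$ be a non-principal ultrafilter on $\mathbb{N}$, $\{m_n\}$ a sequence of positive integers and $\mathcal M=\{\mathrm{Mat}_{m_n\times m_n}(K)\}_{n=1}^\infty$. Let $J$ be the two-sided ideal of $\prod_n\mathrm{Mat}_{m_n\times m_n}(K)$ consisting of the sequences $\{a_n\}$ with $\lim_\omega\mathrm{rank}(a_n)/m_n=0$. Then $\mathrm{Mat}^{\mathcal M}_\omega=\prod_n\mathrm{Mat}_{m_n\times m_n}(K)/J$, with rank function $\mathrm{rk}_{\mathcal M}([\{A_n\}])=\lim_\omega\mathrm{rank}(A_n)/m_n$ for any matrix $[\{A_n\}]$ over $\mathrm{Mat}^{\mathcal M}_\omega$ (where for a $k\times l$ matrix, $A_n$ is regarded as a $km_n\times lm_n$ matrix over $K$). A countable dimensional $K$-algebra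 $\mathcal A$ is sofic if and only if there is an injective unital homomorphism $\phi:\mathcal A\to\mathrm{Mat}^{\mathcal M}_\omega$ for some such $\mathcal M$ and $\omega$; the derived rank function is $\mathrm{rk}_{\mathcal A}(B)=\mathrm{rk}_{\mathcal M}(\tilde\phi(B))$ for matrices $B$ over $\mathcal A$, where $\tilde\phi$ is $\phi$ applied entrywise. $\mathrm{Syl}(R)$ is the set of Sylvester rank functions on $R$, i.e. functions $\mathrm{rk}$ from the set $\mathrm{Mat}(R)$ of all finite rectangular matrices over $R$ to $[0,\infty)$ with $\mathrm{rk}(1)=1$, $\mathrm{rk}\begin{pmatrix}A&0\\0&B\end{pmatrix}=\mathrm{rk}(A)+\mathrm{rk}(B)$, $\mathrm{rk}\begin{pmatrix}A&0\\C&B\end{pmatrix}\ge\mathrm{rk}(A)+\mathrm{rk}(B)$, $\mathrm{rk}(AB)\le\min(\mathrm{rk}(A),\mathrm{rk}(B))$; its topology is pointwise convergence. $\mathrm{Rank}(R)\subset\mathrm{Syl}(R)$ is the set of rank functions induced on $R$ by unital homomorphisms into von Neumann regular $K$-algebras equipped with a Sylvester rank function vanishing only on zero matrices (such as $\mathrm{Mat}^{\mathcal M}_\omega$). For a nonzero finitely generated left $R$-module $M$ and $A\in\mathrm{Mat}_{k\times l}(R)$, $\mathrm{rk}_M(A)$ is the $K$-rank of the linear map $M^l\to M^k$ given by $A$, divided by $\dim_K(M)$. $\mathrm{Fin}(R)=\{\mathrm{rk}_M: M \text{ a nonzero finitely generated left } R\text{-module}\}$. *)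

(* Defs.v *)
From HB Require Import structures.
From mathcomp Require Import all_boot all_order all_algebra all_field.
From mathcomp Require Import all_classical all_reals all_analysis.
Set Implicit Arguments.
Unset Strict Implicit.
Unset Printing Implicit Defensive.
Import Order.TTheory GRing.Theory Num.Theory.
Import numFieldNormedType.Exports.
Local Open Scope classical_set_scope.
Local Open Scope ring_scope.
Local Open Scope quotient_scope.

Record free_ultrafilter := FreeUltrafilter {
  fultra :> set_system nat;
  fultra_ultra : UltraFilter fultra;
  fultra_free : forall n, ~ fultra [set n] }.

#[global] Existing Instance fultra_ultra.

(* In everything below a sequence of positive integers is encoded by its
   predecessors: m : nat -> nat stands for m_n = (m n).+1, so that every factor
   is a nonzero K-algebra. *)
Definition prodmx (K : fieldType) (m : nat -> nat) : Type :=
  forall n, 'M[K]_((m n).+1).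

Section ProdMatrix.
Variables (K : fieldType) (m : nat -> nat).
Local Notation P := (prodmx K m).

HB.instance Definition _ := gen_eqMixin P.
HB.instance Definition _ := gen_choiceMixin P.

Lemma prodmxP (a b : P) : (forall n, a n = b n) -> a = b.
Proof. exact: functional_extensionality_dep. Qed.

Let zeroP : P := fun=> 0.
Let oneP : P := fun=> 1.
Let oppP (a : P) : P := fun n => - a n.
Let addP (a b : P) : P := fun n => a n + b n.
Let mulP (a b : P) : P := fun n => a n * b n.
Let scaleP (c : K) (a : P) : P := fun n => c *: a n.

Let addPA : associative addP.
Proof. by move=> a b c; apply: prodmxP => n; apply: addrA. Qed.
Let addPC : commutative addP.
Proof. by move=> a b; apply: prodmxP => n; apply: addrC. Qed.
Let add0P : left_id zeroP addP.
Proof. by move=> a; apply: prodmxP => n; apply: add0r. Qed.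
Let addNP : left_inverse zeroP oppP addP.
Proof. by move=> a; apply: prodmxP => n; apply: addNr. Qed.
HB.instance Definition _ := GRing.isZmodule.Build P addPA addPC add0P addNP.

Let mulPA : associative mulP.
Proof. by move=> a b c; apply: prodmxP => n; apply: mulrA. Qed.
Let mul1P : left_id oneP mulP.
Proof. by move=> a; apply: prodmxP => n; apply: mul1r. Qed.
Let mulP1 : right_id oneP mulP.
Proof. by move=> a; apply: prodmxP => n; apply: mulr1. Qed.
Let mulPDl : left_distributive mulP addP.
Proof. by move=> a b c; apply: prodmxP => n; apply: mulrDl. Qed.
Let mulPDr : right_distributive mulP addP.
Proof. by move=> a b c; apply: prodmxP => n; apply: mulrDr. Qed.
Let oneP_neq0 : oneP != 0.
Proof.
apply/eqP => /(congr1 (fun a : P => a 0%N)) e10.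
by move/eqP: (oner_neq0 'M[K]_((m 0%N).+1)); apply.
Qed.
HB.instance Definition _ := GRing.Zmodule_isNzRing.Build P
  mulPA mul1P mulP1 mulPDl mulPDr oneP_neq0.

Let scalePA a b v : scaleP a (scaleP b v) = scaleP (a * b) v.
Proof. by apply: prodmxP => n; apply: scalerA. Qed.
Let scale1P : left_id 1 scaleP.
Proof. by move=> a; apply: prodmxP => n; apply: scale1r. Qed.
Let scalePDr : right_distributive scaleP +%R.
Proof. by move=> a b c; apply: prodmxP => n; apply: scalerDr. Qed.
Let scalePDl v : {morph scaleP^~ v : a b / a + b}.
Proof. by move=> a b; apply: prodmxP => n; apply: scalerDl. Qed.
HB.instance Definition _ := GRing.Zmodule_isLmodule.Build K P
  scalePA scale1P scalePDr scalePDl.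
Let scalePAl (a : K) (u v : P) : a *: (u * v) = (a *: u) * v.
Proof. by apply: prodmxP => n; apply: scalerAl. Qed.
HB.instance Definition _ := GRing.Lmodule_isLalgebra.Build K P scalePAl.
Let scalePAr (a : K) (u v : P) : a *: (u * v) = u * (a *: v).
Proof. by apply: prodmxP => n; apply: scalerAr. Qed.
HB.instance Definition _ := GRing.Lalgebra_isAlgebra.Build K P scalePAr.

End ProdMatrix.

Definition rank_ideal (Rl : realType) (K : fieldType) (m : nat -> nat)
    (w : free_ultrafilter) : {pred prodmx K m} :=
  fun a => `[< ((\rank (a n))%:R / (m n).+1%:R : Rl) @[n --> fultra w] --> 0 >].

Section RankIdeal.
Variables (Rl : realType) (K : fieldType) (m : nat -> nat).
Variable w : free_ultrafilter.
Local Notation P := (prodmx K m).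
Local Notation J := (@rank_ideal Rl K m w).
Let nrk (a : P) n : Rl := (\rank (a n))%:R / (m n).+1%:R.

Let JP (a : P) : reflect (nrk a n @[n --> fultra w] --> 0) (a \in J).
Proof. exact: asboolP. Qed.

Let nrk_ge0 a n : 0 <= nrk a n.
Proof. by rewrite divr_ge0 ?ler0n. Qed.

Let J_squeeze (a : P) (f : nat -> Rl) :
  (forall n, nrk a n <= f n) -> f n @[n --> fultra w] --> 0 -> a \in J.
Proof.
move=> le_af f0; apply/JP; apply: (@squeeze_cvgr _ _ _ _ (fun=> 0) f) => //.
  by apply: nearW => n; rewrite nrk_ge0 le_af.
exact: cvg_cst.
Qed.

Let J_le (a b : P) :
  (forall n, (\rank (a n) <= \rank (b n))%N) -> b \in J -> a \in J.
Proof.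
move=> le_ab /JP; apply: J_squeeze => n.
by rewrite ler_wpM2r ?invr_ge0 ?ler0n // ler_nat.
Qed.

Lemma rank_ideal_zmod_closed : zmod_closed J.
Proof.
split=> [|a b Ja Jb].
  apply: (@J_squeeze _ (fun=> 0)) => [n|]; last exact: cvg_cst.
  by rewrite /nrk mxrank0 mul0r.
have /JP Jb' : - b \in J.
  by apply: J_le Jb => n; rewrite -scaleN1r mxrank_scale.
have /JP Ja' := Ja; apply: (@J_squeeze _ (fun n => nrk a n + nrk (- b) n)).
  move=> n; rewrite -mulrDl ler_wpM2r ?invr_ge0 ?ler0n // -natrD ler_nat.
  exact: mxrank_add.
by rewrite -[X in _ --> X]addr0; apply: cvgD.
Qed.

HB.instance Definition _ := GRing.isZmodClosed.Build P J rank_ideal_zmod_closed.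

Lemma rank_idealMl (a u : P) : u \in J -> a * u \in J.
Proof. by apply: J_le => n; apply: mxrankM_maxr. Qed.

Lemma rank_idealMr (a u : P) : u \in J -> u * a \in J.
Proof. by apply: J_le => n; apply: mxrankM_maxl. Qed.

Lemma rank_idealZ (c : K) (u : P) : u \in J -> c *: u \in J.
Proof. by apply: J_le => n; apply: mxrank_scale. Qed.

Lemma rank_ideal1 : 1 \notin J.
Proof.
apply/negP => /JP; have -> : nrk 1 = fun=> 1.
  apply/funext => n; rewrite /nrk.
  by rewrite [X in \rank X](_ : _ = 1%:M) // mxrank1 divff ?pnatr_eq0.
move=> /(cvg_unique (@Rhausdorff Rl) (cvg_cst (1 : Rl)))/eqP.
by rewrite oner_eq0.
Qed.

End RankIdeal.

Definition matU (Rl : realType) (K : fieldType) (m : nat -> nat)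
    (w : free_ultrafilter) : Type :=
  Quotient.quot (@rank_ideal Rl K m w : zmodClosed (prodmx K m)).

Section MatU.
Variables (Rl : realType) (K : fieldType) (m : nat -> nat).
Variable w : free_ultrafilter.
Local Notation P := (prodmx K m).
Local Notation U := (@matU Rl K m w).
Local Notation J := (@rank_ideal Rl K m w).

HB.instance Definition _ := GRing.Zmodule.on U.

Definition matU_pi (a : P) : U := \pi a.
Definition matU_repr (x : U) : P := repr x.
Let one : U := matU_pi 1.
Let mul (x y : U) : U := matU_pi (matU_repr x * matU_repr y).
Let scale (c : K) (x : U) : U := matU_pi (c *: matU_repr x).

Let piP (a b : P) : reflect (matU_pi a = matU_pi b) (a - b \in J).
Proof.
by rewrite (Quotient.idealrBE (J : zmodClosed P)); apply: (iffP eqP).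
Qed.
Let reprU x : matU_pi (matU_repr x) = x.
Proof. exact: reprK. Qed.
Let repr_pi a : matU_repr (matU_pi a) - a \in J.
Proof. by apply/piP; rewrite reprU. Qed.
Let piD a b : matU_pi (a + b) = matU_pi a + matU_pi b.
Proof. by rewrite /matU_pi !piE. Qed.
Let piM a b : matU_pi (a * b) = mul (matU_pi a) (matU_pi b).
Proof.
apply/esym/piP.
rewrite -(subrKA (matU_repr (matU_pi a) * b)) -mulrBr -mulrBl.
by apply: rpredD; [apply: rank_idealMl|apply: rank_idealMr]; apply: repr_pi.
Qed.
Let piZ c a : matU_pi (c *: a) = scale c (matU_pi a).
Proof. by apply/esym/piP; rewrite -scalerBr rank_idealZ ?repr_pi. Qed.
Let pi_ind (Q : U -> Prop) : (forall a, Q (matU_pi a)) -> forall x, Q x.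
Proof. by move=> Qpi x; rewrite -[x]reprU. Qed.

Let mulA : associative mul.
Proof.
by elim/pi_ind=> a; elim/pi_ind=> b; elim/pi_ind=> c; rewrite -!piM mulrA.
Qed.
Let mul1 : left_id one mul.
Proof. by elim/pi_ind=> a; rewrite -piM mul1r. Qed.
Let mulx1 : right_id one mul.
Proof. by elim/pi_ind=> a; rewrite -piM mulr1. Qed.
Let mulDl : left_distributive mul +%R.
Proof.
elim/pi_ind=> a; elim/pi_ind=> b; elim/pi_ind=> c.
by rewrite -piD -!piM -piD mulrDl.
Qed.
Let mulDr : right_distributive mul +%R.
Proof.
elim/pi_ind=> a; elim/pi_ind=> b; elim/pi_ind=> c.
by rewrite -piD -!piM -piD mulrDr.
Qed.
Let one_neq0 : one != 0.
Proof.
have -> : 0 = matU_pi 0 by rewrite /matU_pi !piE.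
by apply/eqP => /piP; rewrite subr0; apply/negP/rank_ideal1.
Qed.
HB.instance Definition _ := GRing.Zmodule_isNzRing.Build U
  mulA mul1 mulx1 mulDl mulDr one_neq0.

Let scaleA a b v : scale a (scale b v) = scale (a * b) v.
Proof. by elim/pi_ind: v => v; rewrite -!piZ scalerA. Qed.
Let scale1 : left_id 1 scale.
Proof. by elim/pi_ind=> v; rewrite -!piZ scale1r. Qed.
Let scaleDr : right_distributive scale +%R.
Proof.
by move=> c; elim/pi_ind=> a; elim/pi_ind=> b; rewrite -piD -!piZ -piD scalerDr.
Qed.
Let scaleDl v : {morph scale^~ v : a b / a + b}.
Proof. by elim/pi_ind: v => v a b; rewrite -!piZ -piD scalerDl. Qed.
HB.instance Definition _ := GRing.Zmodule_isLmodule.Build K U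
  scaleA scale1 scaleDr scaleDl.
Let scaleAl (a : K) (u v : U) : a *: (u * v) = (a *: u) * v.
Proof.
elim/pi_ind: u => u; elim/pi_ind: v => v.
by rewrite -[LHS]/(scale a (mul _ _)) -piM -!piZ scalerAl piM piZ.
Qed.
HB.instance Definition _ := GRing.Lmodule_isLalgebra.Build K U scaleAl.
Let scaleAr (a : K) (u v : U) : a *: (u * v) = u * (a *: v).
Proof.
elim/pi_ind: u => u; elim/pi_ind: v => v.
by rewrite -[LHS]/(scale a (mul _ _)) -piM -!piZ scalerAr piM piZ.
Qed.
HB.instance Definition _ := GRing.Lalgebra_isAlgebra.Build K U scaleAr.

(* The limit does not depend on the representatives: changing the entries by
   elements of J changes the normalized ranks by a sequence tending to 0.  It
   exists because w is an ultrafilter and the normalized ranks lie in [0, k]. *)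
Definition rk_matU k l (B : 'M[U]_(k, l)) : Rl :=
  lim (((\rank (\mxblock_(i < k, j < l) matU_repr (B i j) n))%:R
          / (m n).+1%:R : Rl) @[n --> fultra w]).

End MatU.

Section LinearAlgebra.
Variables (K : fieldType) (V : lmodType K).

Definition lin_indep (B : set V) : Prop :=
  forall (s : seq V) (c : V -> K), uniq s -> [set` s] `<=` B ->
    \sum_(v <- s) c v *: v = 0 -> forall v, v \in s -> c v = 0.

Definition lin_span (B : set V) : set V :=
  [set v | exists (s : seq V) (c : V -> K),
     [set` s] `<=` B /\ v = \sum_(u <- s) c u *: u].

Definition is_basis (W B : set V) : Prop :=
  [/\ B `<=` W, lin_indep B & W `<=` lin_span B].

Definition countable_dim : Prop :=
  exists B : set V, is_basis [set: V] B /\ countable B.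

(* The dimension of a linear subspace W; the junk value 0 is returned when
   W has no finite basis. *)
Definition dimK (W : set V) : nat :=
  xget 0%N [set d | exists B : set V, is_basis W B /\ (B #= `I_d)%card].

End LinearAlgebra.

Definition sofic (Rl : realType) (K : fieldType) (A : algType K) : Prop :=
  countable_dim A /\
  exists (m : nat -> nat) (w : free_ultrafilter)
         (phi : {lrmorphism A -> matU Rl K m w}), injective phi.

Definition rk_sofic (Rl : realType) (K : fieldType) (A : algType K)
    (m : nat -> nat) (w : free_ultrafilter)
    (phi : {lrmorphism A -> matU Rl K m w}) k l (B : 'M[A]_(k, l)) : Rl :=
  rk_matU (map_mx phi B).

(* Matrices with zero rows or columns are allowed; the axioms force their rank
   to be 0, so this does not change the notion. *)
Record sylvester (Rl : realType) (S : nzRingType) := Sylvester {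
  syl_rk :> forall k l, 'M[S]_(k, l) -> Rl;
  syl_ge0 : forall k l (A : 'M[S]_(k, l)), 0 <= syl_rk A;
  syl_1 : syl_rk (1%:M : 'M[S]_1) = 1;
  syl_diag : forall k l k' l' (A : 'M[S]_(k, l)) (B : 'M[S]_(k', l')),
    syl_rk (block_mx A 0 0 B) = syl_rk A + syl_rk B;
  syl_trig : forall k l k' l' (A : 'M[S]_(k, l)) (B : 'M[S]_(k', l'))
      (C : 'M[S]_(k', l)),
    syl_rk A + syl_rk B <= syl_rk (block_mx A 0 C B);
  syl_mul : forall k l p (A : 'M[S]_(k, l)) (B : 'M[S]_(l, p)),
    syl_rk (A *m B) <= Num.min (syl_rk A) (syl_rk B) }.

Definition anymx (S : Type) : Type := {d : nat * nat & 'M[S]_(d.1, d.2)}.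

Definition syl_ptws (Rl : realType) (S : nzRingType) (r : sylvester Rl S) :
    {ptws anymx S -> Rl} :=
  fun A => r _ _ (projT2 A).

(* The topology of pointwise convergence on Syl(S), as a subspace of the
   product of copies of Rl indexed by all matrices. *)
Section SylvesterTopology.
Variables (Rl : realType) (S : nzRingType).
HB.instance Definition _ := gen_eqMixin (sylvester Rl S).
HB.instance Definition _ := gen_choiceMixin (sylvester Rl S).
HB.instance Definition _ :=
  Topological.copy (sylvester Rl S) (initial_topology (@syl_ptws Rl S)).
End SylvesterTopology.

Definition von_neumann_regular (N : nzRingType) : Prop :=
  forall a : N, exists x, a = a * x * a.

Definition syl_faithful (Rl : realType) (N : nzRingType)
    (r : sylvester Rl N) : Prop :=
  forall k l (A : 'M[N]_(k, l)), r k l A = 0 -> A = 0.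

Definition rank_spectrum (Rl : realType) (K : fieldType) (R : algType K) :
    set (sylvester Rl R) :=
  [set r | exists (N : algType K) (rN : sylvester Rl N)
             (f : {lrmorphism R -> N}),
     [/\ von_neumann_regular N, syl_faithful rN &
         forall k l (A : 'M[R]_(k, l)), r k l A = rN k l (map_mx f A)]].

Definition restrict_scalars (K : fieldType) (R : algType K) (M : lmodType R) :
  Type := M.

Section RestrictScalars.
Variables (K : fieldType) (R : algType K) (M : lmodType R).
Local Notation MK := (restrict_scalars M).
HB.instance Definition _ := GRing.Zmodule.on MK.
Let scale (c : K) (x : MK) : MK := (c%:A : R) *: (x : M).
Let scaleA a b x : scale a (scale b x) = scale (a * b) x.
Proof. by rewrite /scale scalerA -scalerAl mul1r scalerA. Qed.
Let scale1 : left_id 1 scale.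
Proof. by move=> x; rewrite /scale !scale1r. Qed.
Let scaleDr : right_distributive scale +%R.
Proof. by move=> c x y; apply: scalerDr. Qed.
Let scaleDl x : {morph scale^~ x : a b / a + b}.
Proof. by move=> a b; rewrite /scale !scalerDl. Qed.
HB.instance Definition _ := GRing.Zmodule_isLmodule.Build K MK
  scaleA scale1 scaleDr scaleDl.
End RestrictScalars.

Definition finitely_generated (R : nzRingType) (M : lmodType R) : Prop :=
  exists (n : nat) (g : 'I_n -> M),
    forall x, exists c : 'I_n -> R, x = \sum_i c i *: g i.

Definition mulmod (R : nzRingType) (M : lmodType R) k l (A : 'M[R]_(k, l))
    (x : {ffun 'I_l -> M}) : {ffun 'I_k -> M} :=
  [ffun i => \sum_j A i j *: x j].

Definition rk_mod (Rl : realType) (K : fieldType) (R : algType K)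
    (M : lmodType R) k l (A : 'M[R]_(k, l)) : Rl :=
  (dimK (range (mulmod A : {ffun 'I_l -> M} ->
                           {ffun 'I_k -> restrict_scalars M})))%:R
  / (dimK [set: restrict_scalars M])%:R.

Definition Fin (Rl : realType) (K : fieldType) (R : algType K) :
    set (sylvester Rl R) :=
  [set r | exists M : lmodType R,
     [/\ exists x : M, x != 0, finitely_generated M &
         forall k l (A : 'M[R]_(k, l)), r k l A = rk_mod Rl M A]].

(* Main.v *)
From HB Require Import structures.
Require Import Defs.
From mathcomp Require Import all_boot all_order all_algebra all_field.
From mathcomp Require Import all_classical all_reals all_analysis.
From mathcomp Require Import finmap zify lra.
Set Implicit Arguments.
Unset Strict Implicit.
Unset Printing Implicit Defensive.
Import Order.TTheory GRing.Theory Num.Theory.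
Import numFieldNormedType.Exports.
Local Open Scope classical_set_scope.
Local Open Scope ring_scope.

(** Lift the basis of R, mapped to the ultraproduct, to matrices over K; this
    gives linear maps psi_n from R to the m_n by m_n matrices whose
    multiplicativity and unit defects on the basis have total rank delta_n with
    delta_n / m_n tending to 0 along the ultrafilter.  The common kernel W of
    these defects has codimension at most delta_n, and psi_n(R) W is stable
    under psi_n(R), contains W, and carries an honest R-module structure: by
    the vanishing of the defects on W, for w in W
      psi_n(a) psi_n(b) psi_n(c) w = psi_n(abc) w = psi_n(ab) psi_n(c) w.
    The ranks of matrices over R acting on this module and through psi_n differ
    by O(delta_n), so the rank functions of these modules converge to rk_rho
    along the ultrafilter. *)

(** * Ranks of block matrices *)

Section RankBlocks.
Variable K : fieldType.

(** Selecting rows and columns, even with repetitions, is multiplication on both sides by selections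
    from identity matrices. *)
Lemma mxrank_mxsub m n m' n' (f : 'I_m' -> 'I_m) (g : 'I_n' -> 'I_n)
    (A : 'M[K]_(m, n)) : (\rank (mxsub f g A) <= \rank A)%N.
Proof.
rewrite (_ : mxsub f g A = rowsub f 1%:M *m A *m colsub g 1%:M).
  exact: leq_trans (mxrankM_maxl _ _) (mxrankM_maxr _ _).
by rewrite mul_rowsub_mx mul1mx -mxsub_mul mulmx1.
Qed.

(** One-sided inverses of the factors in the rank factorisations of [A] and [B] turn the diagonal
    blocks into identities of sizes [\rank A] and [\rank B]; the resulting unitriangular matrix is
    invertible. *)
Lemma rank_block_lower_ge m n p q (A : 'M[K]_(m, n)) (B : 'M[K]_(p, q))
    (C : 'M[K]_(p, n)) :
  (\rank A + \rank B <= \rank (block_mx A 0 C B))%N.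
Proof.
pose L := block_mx (pinvmx (col_base A)) 0 0 (pinvmx (col_base B)).
pose R := block_mx (pinvmx (row_base A)) 0 0 (pinvmx (row_base B)).
have sandwich s t (D : 'M[K]_(s, t)) :
    pinvmx (col_base D) *m D *m pinvmx (row_base D) = 1%:M.
  transitivity (pinvmx (col_base D) *m (col_base D *m row_base D)
                *m pinvmx (row_base D)); first by rewrite mulmx_base.
  rewrite mulmxA mulVpmx ?col_base_full // mul1mx.
  by rewrite mulmxVp ?row_base_free.
have LMR : exists C', L *m block_mx A 0 C B *m R = block_mx 1%:M 0 C' 1%:M.
  rewrite !mulmx_block !(mul0mx, mulmx0, addr0, add0r) !sandwich; eexists.
  by congr block_mx.
case: LMR => C' eLMR.
have <- : \rank (L *m block_mx A 0 C B *m R) = (\rank A + \rank B)%N.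
  rewrite eLMR mxrank_unit // unitmxE det_lblock !det1 mulr1; exact: unitr1.
exact: leq_trans (mxrankM_maxl _ _) (mxrankM_maxr _ _).
Qed.

Section ConstantBlocks.
Variables (p q : nat).

Lemma mxblock_Rank k l (G : 'I_k -> 'I_l -> 'M[K]_(p, q)) i j s t :
  (\mxblock_(i, j) G i j) (tagnat.Rank (p_ := fun=> p) i s)
     (tagnat.Rank (p_ := fun=> q) j t) = G i j s t.
Proof.
have sig2_Rank n r (x : 'I_n) (y : 'I_r) :
  tagnat.sig2 (tagnat.Rank (p_ := fun=> r) x y) = y :> 'I_r.
  by apply: val_inj; rewrite /= tagnat.Rank2K.
by rewrite mxE !sig2_Rank !tagnat.Rank1K.
Qed.

Variables (k k' l l' : nat).

(** The entries agree but the index types differ: the maps [e] and [e'] exhibit each matrix as a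
    submatrix of the other, which avoids casts. *)
Lemma rank_mxblock_split (G : 'I_(k + k') -> 'I_(l + l') -> 'M[K]_(p, q)) :
  \rank (\mxblock_(i, j) G i j) =
  \rank (block_mx (\mxblock_(i < k, j < l) G (lshift k' i) (lshift l' j))
                  (\mxblock_(i < k, j < l') G (lshift k' i) (rshift l j))
                  (\mxblock_(i < k', j < l) G (rshift k i) (lshift l' j))
                  (\mxblock_(i < k', j < l') G (rshift k i) (rshift l j))).
Proof.
pose e a b r (u : 'I_(\sum_(i < a + b) r)) :
    'I_(\sum_(i < a) r + \sum_(i < b) r) :=
  match fintype.split (tagnat.sig1 u) with
  | inl i => lshift _ (tagnat.Rank (p_ := fun=> r) i (tagnat.sig2 u))
  | inr i => rshift _ (tagnat.Rank (p_ := fun=> r) i (tagnat.sig2 u)) end.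
pose e' a b r (v : 'I_(\sum_(i < a) r + \sum_(i < b) r)) :
    'I_(\sum_(i < a + b) r) :=
  match fintype.split v with
  | inl u => tagnat.Rank (p_ := fun=> r)
               (lshift b (tagnat.sig1 u)) (tagnat.sig2 u)
  | inr u => tagnat.Rank (p_ := fun=> r)
               (rshift a (tagnat.sig1 u)) (tagnat.sig2 u) end.
apply/eqP; rewrite eqn_leq; apply/andP; split; set X := mxblock G;
  set Y := block_mx _ _ _ _.
  rewrite (_ : X = mxsub (@e _ _ _) (@e _ _ _) Y) ?mxrank_mxsub //.
  apply/matrixP => u v; rewrite mxE [RHS]mxE /e.
  have := splitK (tagnat.sig1 u); have := splitK (tagnat.sig1 v).
  case: (fintype.split (tagnat.sig1 u)) => i;
  case: (fintype.split (tagnat.sig1 v)) => j /= <- <-;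
  by rewrite ?(block_mxEul, block_mxEur, block_mxEdl, block_mxEdr) mxblock_Rank.
rewrite (_ : Y = mxsub (@e' _ _ _) (@e' _ _ _) X) ?mxrank_mxsub //.
apply/matrixP => u v; rewrite [RHS]mxE /e'.
rewrite -{1}[u]splitK -{1}[v]splitK.
case: (fintype.split u) => i; case: (fintype.split v) => j /=;
by rewrite ?(block_mxEul, block_mxEur, block_mxEdl, block_mxEdr) mxblock_Rank
  mxE.
Qed.
End ConstantBlocks.

Lemma mxrank_mxblock_le k l (p_ : 'I_k -> nat) (q_ : 'I_l -> nat)
    (B : forall i j, 'M[K]_(p_ i, q_ j)) :
  (\rank (\mxblock_(i, j) B i j) <= \sum_i \sum_j \rank (B i j))%N.
Proof.
have mxcol_le n (r_ : 'I_n -> nat) m (V : forall i, 'M[K]_(r_ i, m)) :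
    (\rank (\mxcol_i V i) <= \sum_i \rank (V i))%N.
  rewrite (eqmx_col V); apply: leq_trans (mxrank_sum_leqif _).1 _ => /=.
  by apply: leq_sum => i _; rewrite genmxE.
rewrite mxblockEv; apply: leq_trans (mxcol_le _ _ _ _) _; apply: leq_sum => i _.
rewrite -mxrank_tr tr_mxrow; apply: leq_trans (mxcol_le _ _ _ _) _.
by apply: leq_sum => j _; rewrite mxrank_tr.
Qed.

Lemma mxrank_le_mxblock k l (p_ : 'I_k -> nat) (q_ : 'I_l -> nat)
    (B : forall i j, 'M[K]_(p_ i, q_ j)) i j :
  (\rank (B i j) <= \rank (\mxblock_(i, j) B i j))%N.
Proof. by rewrite -{1}(mxblockK B i j) mxrank_mxsub. Qed.

End RankBlocks.

(** * The rank function of the ultraproduct *)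

Section BlockRank.
Variables (Rl : realType) (K : fieldType).

(** The entries form a function, so that a matrix over ['M[K]_d.+1] and the coordinates at [n] of a
    family of lifts both fit. *)
Definition blockrk d k l (G : 'I_k -> 'I_l -> 'M[K]_d.+1) : Rl :=
  (\rank (\mxblock_(i, j) G i j))%:R / d.+1%:R.

Variable d : nat.

Lemma eq_blockrk k l (G H : 'I_k -> 'I_l -> 'M[K]_d.+1) :
  (forall i j, G i j = H i j) -> blockrk G = blockrk H.
Proof. by move=> eGH; congr blockrk; apply/funext => i; apply/funext. Qed.

Lemma blockrk_ge0 k l (G : 'I_k -> 'I_l -> 'M[K]_d.+1) : 0 <= blockrk G.
Proof. by rewrite divr_ge0 ?ler0n. Qed.

Lemma blockrk_le k l (G : 'I_k -> 'I_l -> 'M[K]_d.+1) : blockrk G <= k%:R.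
Proof.
rewrite ler_pdivrMr ?ltr0Sn // -natrM ler_nat.
by apply: leq_trans (rank_leq_row _) _; rewrite sum_nat_const card_ord.
Qed.

Lemma blockrk1 : blockrk (fun _ _ : 'I_1 => 1 : 'M[K]_d.+1) = 1.
Proof.
rewrite /blockrk (_ : \rank _ = d.+1) ?divff ?pnatr_eq0 //.
apply/eqP; rewrite eqn_leq; apply/andP; split.
  by apply: leq_trans (rank_leq_row _) _; rewrite sum_nat_const card_ord mul1n.
apply: leq_trans (mxrank_le_mxblock _ ord0 ord0).
by rewrite [X in \rank X](_ : _ = 1%:M) // mxrank1.
Qed.

Section Blocks.
Variables (k l k' l' : nat) (G : 'I_(k + k') -> 'I_(l + l') -> 'M[K]_d.+1).
Let Gul := fun i j => G (lshift k' i) (lshift l' j).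
Let Gdr := fun i j => G (rshift k i) (rshift l j).
Hypothesis Gur0 : forall i j, G (lshift k' i) (rshift l j) = 0.

Let Gur : \mxblock_(i < k, j < l') G (lshift k' i) (rshift l j) = 0.
Proof. by apply/matrixP => u v; rewrite !mxE Gur0 mxE. Qed.

Lemma blockrk_trig : blockrk Gul + blockrk Gdr <= blockrk G.
Proof.
rewrite -mulrDl ler_wpM2r ?invr_ge0 ?ler0n // -natrD ler_nat.
by rewrite rank_mxblock_split Gur rank_block_lower_ge.
Qed.

Lemma blockrk_diag : (forall i j, G (rshift k i) (lshift l' j) = 0) ->
  blockrk G = blockrk Gul + blockrk Gdr.
Proof.
move=> Gdl0; rewrite -mulrDl -natrD /blockrk rank_mxblock_split Gur.
have -> : \mxblock_(i < k', j < l) G (rshift k i) (lshift l' j) = 0.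
  by apply/matrixP => u v; rewrite !mxE Gdl0 mxE.
by rewrite rank_diag_block_mx.
Qed.
End Blocks.

Lemma blockrk_mul k l p (G : 'I_k -> 'I_l -> 'M[K]_d.+1)
    (H : 'I_l -> 'I_p -> 'M[K]_d.+1) :
  blockrk (fun i j => \sum_h G i h * H h j)
    <= Num.min (blockrk G) (blockrk H).
Proof.
have eGH := mul_mxblock G H.
by rewrite le_min !ler_wpM2r ?invr_ge0 ?ler0n // ler_nat /blockrk -eGH
  ?mxrankM_maxl ?mxrankM_maxr.
Qed.

Lemma mxrank_subr m n (A B : 'M[K]_(m, n)) :
  (\rank A <= \rank B + \rank (A - B)%R)%N.
Proof. by have := mxrank_add B (A - B); rewrite addrC subrK. Qed.

(** By subadditivity, perturbing the blocks changes the rank by at most the total rank of the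
    perturbations. This makes limits independent of representatives. *)
Lemma blockrk_dist k l (G H : 'I_k -> 'I_l -> 'M[K]_d.+1) :
  `|blockrk G - blockrk H|
    <= \sum_i \sum_j (\rank (G i j - H i j))%:R / d.+1%:R.
Proof.
have half (G' H' : 'I_k -> 'I_l -> 'M[K]_d.+1) : blockrk G' - blockrk H'
    <= \sum_i \sum_j (\rank (G' i j - H' i j))%:R / d.+1%:R.
  have -> : \sum_i \sum_j (\rank (G' i j - H' i j))%:R / d.+1%:R =
      (\sum_i \sum_j \rank (G' i j - H' i j)%R)%:R / d.+1%:R :> Rl.
    rewrite natr_sum mulr_suml; apply: eq_bigr => i _.
    by rewrite natr_sum mulr_suml.
  rewrite -mulrBl ler_wpM2r ?invr_ge0 ?ler0n // lerBlDl.
  rewrite -natrD ler_nat; apply: leq_trans (mxrank_subr _ (mxblock H')) _.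
  by rewrite leq_add2l -mxblockB mxrank_mxblock_le.
rewrite ler_norml half andbT lerNl opprB; apply: le_trans (half _ _) _.
rewrite le_eqVlt; apply/orP; left; apply/eqP.
apply: eq_bigr => i _; apply: eq_bigr => j _.
by rewrite -opprB -scaleN1r mxrank_scale_nz // oppr_eq0 oner_eq0.
Qed.

End BlockRank.

(** * Sylvester rank functions: pullbacks and matrix algebras *)

Lemma sylvester_comap (Rl : realType) (S T : nzRingType)
    (f : {rmorphism S -> T}) (r : sylvester Rl T) :
  exists r' : sylvester Rl S, forall k l (B : 'M[S]_(k, l)),
    r' k l B = r k l (map_mx f B).
Proof.
pose rk k l (B : 'M[S]_(k, l)) := r k l (map_mx f B).
have rk_ge0 k l (B : 'M[S]_(k, l)) : 0 <= rk k l B by apply: syl_ge0.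
have rk_1 : rk _ _ (1%:M : 'M[S]_1) = 1 by rewrite /rk map_mx1 syl_1.
have rk_diag k l k' l' (B : 'M[S]_(k, l)) (C : 'M[S]_(k', l')) :
    rk _ _ (block_mx B 0 0 C) = rk _ _ B + rk _ _ C.
  by rewrite /rk map_block_mx !map_mx0 syl_diag.
have rk_trig k l k' l' (B : 'M[S]_(k, l)) (C : 'M[S]_(k', l'))
    (D : 'M[S]_(k', l)) :
    rk _ _ B + rk _ _ C <= rk _ _ (block_mx B 0 D C).
  by rewrite /rk map_block_mx map_mx0 syl_trig.
have rk_mul k l p (B : 'M[S]_(k, l)) (C : 'M[S]_(l, p)) :
    rk _ _ (B *m C) <= Num.min (rk _ _ B) (rk _ _ C).
  by rewrite /rk map_mxM syl_mul.
by exists (Sylvester rk_ge0 rk_1 rk_diag rk_trig rk_mul).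
Qed.

Lemma blockrk_sylvester (Rl : realType) (K : fieldType) d :
  exists r : sylvester Rl 'M[K]_d.+1,
    forall k l (A : 'M['M[K]_d.+1]_(k, l)), r k l A = blockrk Rl A.
Proof.
pose rk k l (A : 'M['M[K]_d.+1]_(k, l)) := blockrk Rl A.
have rk_ge0 k l (A : 'M['M[K]_d.+1]_(k, l)) : 0 <= rk k l A.
  exact: blockrk_ge0.
have rk_1 : rk _ _ (1%:M : 'M['M[K]_d.+1]_1) = 1.
  rewrite -[RHS](blockrk1 Rl K d); apply: eq_blockrk => i j.
  by rewrite !ord1 mxE.
have rk_diag k l k' l' (A : 'M['M[K]_d.+1]_(k, l))
    (B : 'M['M[K]_d.+1]_(k', l')) :
    rk _ _ (block_mx A 0 0 B) = rk _ _ A + rk _ _ B.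
  rewrite /rk blockrk_diag;
    try by move=> i j; rewrite ?(block_mxEur, block_mxEdl) mxE.
  by congr (_ + _); apply: eq_blockrk => i j;
    rewrite ?(block_mxEul, block_mxEdr).
have rk_trig k l k' l' (A : 'M['M[K]_d.+1]_(k, l))
    (B : 'M['M[K]_d.+1]_(k', l')) (C : 'M['M[K]_d.+1]_(k', l)) :
    rk _ _ A + rk _ _ B <= rk _ _ (block_mx A 0 C B).
  apply: le_trans (blockrk_trig _ _); last first.
    by move=> i j; rewrite block_mxEur mxE.
  rewrite le_eqVlt; apply/orP; left; apply/eqP.
  by congr (_ + _); apply: eq_blockrk => i j;
    rewrite ?(block_mxEul, block_mxEdr).
have rk_mul k l p (A : 'M['M[K]_d.+1]_(k, l)) (B : 'M['M[K]_d.+1]_(l, p)) :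
    rk _ _ (A *m B) <= Num.min (rk _ _ A) (rk _ _ B).
  apply: le_trans (blockrk_mul _ _ _); rewrite le_eqVlt; apply/orP; left.
  by apply/eqP/eq_blockrk => i j; rewrite mxE.
by exists (Sylvester rk_ge0 rk_1 rk_diag rk_trig rk_mul).
Qed.

(** The image ultrafilter contains a compact segment, hence has a cluster point [p]. For a
    neighbourhood [B] of [p], either [B] or its complement is in that ultrafilter, and clustering
    excludes the complement. *)
Lemma ultra_bounded_cvg (Rl : realType) (w : free_ultrafilter) (u : nat -> Rl)
    (a b : Rl) : (forall n, a <= u n <= b) -> cvg (u n @[n --> fultra w]).
Proof.
move=> uab; have /(_ (u @ fultra w) _ _)[] := @segment_compact Rl a b.
  by apply: nearW => n; rewrite /= in_itv /= uab.
move=> p [_ clp]; apply/cvg_ex; exists p => B Bp.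
have [//|FnB] := in_ultra_setVsetC (u @^-1` B) (fultra_ultra w).
by have [x [? ?]] := clp (~` B) B FnB Bp.
Qed.

Lemma cvg_sumr (Rl : realType) (w : free_ultrafilter) I (r : seq I)
    (u : I -> nat -> Rl) (l : I -> Rl) :
  (forall i, u i n @[n --> fultra w] --> l i) ->
  \sum_(i <- r) u i n @[n --> fultra w] --> \sum_(i <- r) l i.
Proof.
by move=> ul; apply: cvg_big => //; exact: add_continuous.
Qed.

(** * The ultraproduct is regular and its rank function is faithful *)

Section MatURank.
Variables (Rl : realType) (K : fieldType) (m : nat -> nat).
Variable w : free_ultrafilter.
Local Notation P := (prodmx K m).
Local Notation U := (@matU Rl K m w).
Local Notation J := (@rank_ideal Rl K m w).
Local Notation pi := (@matU_pi Rl K m w).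
Local Open Scope quotient_scope.

Lemma matU_piP (a b : P) : pi a = pi b <-> a - b \in J.
Proof.
by rewrite (Quotient.idealrBE (J : zmodClosed P)); split=> [|/eqP//] => /eqP.
Qed.

Lemma matU_reprK (x : U) : pi (matU_repr x) = x.
Proof. exact: reprK. Qed.

Lemma matU_piD : {morph pi : a b / a + b}.
Proof. by move=> a b; rewrite /matU_pi !piE. Qed.

Lemma matU_pi0 : pi 0 = 0.
Proof. by rewrite /matU_pi !piE. Qed.

Lemma matU_pi1 : pi 1 = 1.
Proof. by []. Qed.

Lemma matU_repr_pi a : matU_repr (pi a) - a \in J.
Proof. by apply/matU_piP; rewrite matU_reprK. Qed.

Lemma matU_piM : {morph pi : a b / a * b}.
Proof.
move=> a b; apply/esym/matU_piP.
rewrite -(subrKA (matU_repr (pi a) * b)) -mulrBr -mulrBl.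
by apply: rpredD; [apply: rank_idealMl|apply: rank_idealMr];
  apply: matU_repr_pi.
Qed.

Lemma matU_piZ c : {morph pi : a / c *: a}.
Proof.
by move=> a; apply/esym/matU_piP; rewrite -scalerBr rank_idealZ ?matU_repr_pi.
Qed.

Lemma matU_pi_sum I (r : seq I) (F : I -> P) :
  pi (\sum_(i <- r) F i) = \sum_(i <- r) pi (F i).
Proof. by rewrite (big_morph _ matU_piD matU_pi0). Qed.

Lemma prodmx_sumE I (r : seq I) (F : I -> P) n :
  (\sum_(i <- r) F i : P) n = \sum_(i <- r) F i n.
Proof. exact: (big_morph (fun a : P => a n)). Qed.

Lemma rank_idealP (a : P) :
  a \in J <-> ((\rank (a n))%:R / (m n).+1%:R : Rl) @[n --> fultra w] --> 0.
Proof. by split=> [/asboolP|?] //; apply/asboolP. Qed.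

(** For the chosen representatives the limit exists by boundedness; any other lift differs from them
    by elements of the ideal, and [blockrk_dist] absorbs the difference. Limits can thus be computed
    with the most convenient lift. *)
Lemma rk_matU_cvg k l (F : 'I_k -> 'I_l -> P) (B : 'M[U]_(k, l)) :
  (forall i j, pi (F i j) = B i j) ->
  blockrk Rl (fun i j => F i j n) @[n --> fultra w] --> rk_matU B.
Proof.
move=> FB; pose H := fun n i j => matU_repr (B i j) n.
have Hcvg : blockrk Rl (H n) @[n --> fultra w] --> rk_matU B.
  apply: (@ultra_bounded_cvg _ _ _ 0 k%:R) => n.
  by rewrite blockrk_ge0 blockrk_le.
pose E n := blockrk Rl (fun i j => F i j n) - blockrk Rl (H n).
suff Ecvg : E n @[n --> fultra w] --> (0 : Rl).
  rewrite -[rk_matU B]addr0.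
  rewrite (_ : (fun n => _) = (fun n => blockrk Rl (H n) + E n)).
    exact: cvgD.
  by apply/funext => n; rewrite /E subrKC.
apply/norm_cvg0P.
pose D n := \sum_i \sum_j
  ((\rank (F i j n - H n i j))%:R / (m n).+1%:R : Rl).
apply: (@squeeze_cvgr _ _ _ _ (fun=> 0) D); last 2 first.
- exact: cvg_cst.
- rewrite (_ : (0 : Rl) = \sum_(i < k) \sum_(j < l) 0); last first.
    by rewrite big1 // => i _; rewrite big1.
  apply: cvg_sumr => i; apply: cvg_sumr => j.
  apply: (@rank_idealP (F i j - matU_repr (B i j))).1.
  by apply/matU_piP; rewrite matU_reprK.
by apply: nearW => n; rewrite normr_ge0 blockrk_dist.
Qed.

Lemma rk_matU_sylvester : exists r : sylvester Rl U,
  forall k l (B : 'M[U]_(k, l)), r k l B = rk_matU B.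
Proof.
have rkC k l (B : 'M[U]_(k, l)) :
    blockrk Rl (fun i j => matU_repr (B i j) n) @[n --> fultra w] --> rk_matU B.
  by apply: rk_matU_cvg => i j; apply: matU_reprK.
have rk_ge0 k l (B : 'M[U]_(k, l)) : 0 <= rk_matU B.
  by apply: (cvgr_to_ge (rkC _ _ B)); apply: nearW => n; exact: blockrk_ge0.
have rk_1 : rk_matU (1%:M : 'M[U]_1) = 1.
  apply: (cvg_unique (@Rhausdorff Rl)
    (@rk_matU_cvg _ _ (fun _ _ : 'I_1 => 1) _ _)).
    by move=> i j; rewrite !ord1 mxE matU_pi1.
  rewrite (_ : (fun n => _) = fun=> 1); first exact: cvg_cst.
  by apply/funext => n; exact: blockrk1.
pose F k l (B : 'M[U]_(k, l)) i j := matU_repr (B i j).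
(* The upper right block is lifted by exact zeros and not by chosen representatives, so that the
   lift is block triangular at every [n] and the axioms pass to the limit. *)
pose Fblock k l k' l' (B : 'M[U]_(k, l)) (B' : 'M[U]_(k', l'))
    (c : 'I_k' -> 'I_l -> P) (i : 'I_(k + k')) (j : 'I_(l + l')) : P :=
  match fintype.split i, fintype.split j with
  | inl i, inl j => F _ _ B i j | inl _, inr _ => 0
  | inr i, inl j => c i j | inr i, inr j => F _ _ B' i j
  end.
have Fblock_pi k l k' l' (B : 'M[U]_(k, l)) (B' : 'M[U]_(k', l'))
    (C : 'M[U]_(k', l)) c : (forall i j, pi (c i j) = C i j) ->
    forall i j, pi (Fblock _ _ _ _ B B' c i j) = block_mx B 0 C B' i j.
  move=> cC i j; rewrite /Fblock /F -[in RHS](splitK i) -[in RHS](splitK j).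
  case: (fintype.split i) => i'; case: (fintype.split j) => j' /=;
  by rewrite ?(block_mxEul, block_mxEur, block_mxEdl, block_mxEdr)
    ?matU_reprK // mxE matU_pi0.
have Fblock_split k l k' l' (B : 'M[U]_(k, l)) (B' : 'M[U]_(k', l')) c :
  let G := Fblock _ _ _ _ B B' c in
  [/\ forall i j, G (lshift k' i) (lshift l' j) = F _ _ B i j,
      forall i j, G (lshift k' i) (rshift l j) = 0,
      forall i j, G (rshift k i) (lshift l' j) = c i j &
      forall i j, G (rshift k i) (rshift l j) = F _ _ B' i j].
  by split=> i j; rewrite /Fblock -?[lshift _ _]/(unsplit (inl _))
     -?[rshift _ _]/(unsplit (inr _)) !unsplitK.
have rk_diag k l k' l' (B : 'M[U]_(k, l)) (B' : 'M[U]_(k', l')) :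
    rk_matU (block_mx B 0 0 B') = rk_matU B + rk_matU B'.
  pose c (i : 'I_k') (j : 'I_l) : P := 0.
  have c0 i j : pi (c i j) = (0 : 'M[U]_(k', l)) i j by rewrite mxE matU_pi0.
  apply: (cvg_unique (@Rhausdorff Rl)
    (rk_matU_cvg (Fblock_pi _ _ _ _ B B' _ _ c0))).
  rewrite (_ : (fun n => _) = fun n => blockrk Rl (fun i j => F _ _ B i j n)
    + blockrk Rl (fun i j => F _ _ B' i j n)).
    exact: cvgD (rkC _ _ B) (rkC _ _ B').
  apply/funext => n; have [e1 e2 e3 e4] := Fblock_split _ _ _ _ B B' c.
  rewrite blockrk_diag; try by move=> i j; rewrite ?e2 ?e3.
  by congr (_ + _); apply: eq_blockrk => i j; rewrite ?e1 ?e4.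
have rk_trig k l k' l' (B : 'M[U]_(k, l)) (B' : 'M[U]_(k', l'))
    (C : 'M[U]_(k', l)) :
    rk_matU B + rk_matU B' <= rk_matU (block_mx B 0 C B').
  have cvB := rk_matU_cvg (Fblock_pi _ _ _ _ B B' C (F _ _ C)
    (fun _ _ => matU_reprK _)).
  apply: ler_cvg_to (cvgD (rkC _ _ B) (rkC _ _ B')) cvB _.
  apply: nearW => n; have [e1 e2 e3 e4] := Fblock_split _ _ _ _ B B' (F _ _ C).
  apply: le_trans (blockrk_trig _ _); last by move=> i j; rewrite e2.
  rewrite le_eqVlt; apply/orP; left; apply/eqP.
  by congr (_ + _); apply: eq_blockrk => i j; rewrite ?e1 ?e4.
have rk_mul k l p (B : 'M[U]_(k, l)) (C : 'M[U]_(l, p)) :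
    rk_matU (B *m C) <= Num.min (rk_matU B) (rk_matU C).
  have cvBC : blockrk Rl (fun i j =>
      (\sum_h F _ _ B i h * F _ _ C h j : P) n) @[n --> fultra w]
        --> rk_matU (B *m C).
    apply: rk_matU_cvg => i j; rewrite matU_pi_sum mxE; apply: eq_bigr => h _.
    by rewrite matU_piM !matU_reprK.
  have le_min_n n : blockrk Rl (fun i j =>
      (\sum_h F _ _ B i h * F _ _ C h j : P) n) <=
    Num.min (blockrk Rl (fun i j => F _ _ B i j n))
      (blockrk Rl (fun i j => F _ _ C i j n)).
    apply: le_trans (blockrk_mul _ _ _).
    rewrite le_eqVlt; apply/orP; left; apply/eqP.
    by apply: eq_blockrk => i j; rewrite prodmx_sumE.
  rewrite le_min; apply/andP; split.
    apply: ler_cvg_to cvBC (rkC _ _ B) _; apply: nearW => n.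
    by apply: le_trans (le_min_n n) _; rewrite ge_min lexx.
  apply: ler_cvg_to cvBC (rkC _ _ C) _; apply: nearW => n.
  by apply: le_trans (le_min_n n) _; rewrite ge_min lexx orbT.
by exists (Sylvester rk_ge0 rk_1 rk_diag rk_trig rk_mul).
Qed.

(** An entry has rank at most that of the whole block matrix, so a zero limit puts a representative
    of every entry in the ideal. *)
Lemma rk_matU_eq0 k l (B : 'M[U]_(k, l)) : rk_matU B = 0 -> B = 0.
Proof.
move=> rkB0; apply/matrixP => i j; rewrite mxE -(matU_reprK (B i j)) -matU_pi0.
apply/matU_piP; rewrite subr0; apply/rank_idealP.
apply: (@squeeze_cvgr _ _ _ _ (fun=> 0)
  (fun n => blockrk Rl (fun i j => matU_repr (B i j) n))).
- apply: nearW => n; rewrite divr_ge0 ?ler0n //= ler_wpM2r ?invr_ge0 ?ler0n //.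
  by rewrite ler_nat (mxrank_le_mxblock (fun i j => matU_repr (B i j) n)).
- exact: cvg_cst.
- by rewrite -rkB0; apply: rk_matU_cvg => *; exact: matU_reprK.
Qed.

Lemma matU_regular : von_neumann_regular U.
Proof.
move=> a; have [b ->] : exists b, a = pi b.
  by exists (matU_repr a); rewrite matU_reprK.
(* Pseudo-inverses in the factors give a quasi-inverse in the quotient. *)
exists (pi (fun n => pinvmx (b n))).
rewrite -(matU_piM b) -(matU_piM _ b); congr pi.
by apply: prodmxP => n; rewrite [RHS]mulmxKpV.
Qed.

End MatURank.

(** * Dimension of subspaces *)

Section Dimension.
Variables (K : fieldType) (V : lmodType K).
Implicit Types (s t : seq V) (B W : set V).

(** [lin_span] admits sequences with repeated vectors; coefficients of equal vectors are collected
    along the repetition-free [t]. *)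
Lemma lin_comb_subseq s t (c : V -> K) : uniq t -> [set` s] `<=` [set` t] ->
  exists c', \sum_(v <- s) c v *: v = \sum_(v <- t) c' v *: v.
Proof.
move=> t_uniq; elim: s => [|u s IHs] st.
  by exists (fun=> 0); rewrite big_nil big1 // => v _; rewrite scale0r.
have [|c' e] := IHs; first by move=> v sv; apply: st; rewrite /= inE sv orbT.
have tu : u \in t by apply: st; rewrite /= mem_head.
exists (fun v => c' v + (if v == u then c u else 0)); rewrite big_cons e.
under [RHS]eq_bigr do rewrite scalerDl.
rewrite big_split /= addrC; congr (_ + _).
rewrite (bigD1_seq u) //= eqxx big1 ?addr0 // => v /negbTE ->.
by rewrite scale0r.
Qed.

(** If [s] were longer, its coordinates over [t] would form a matrix with more rows than columns,
    and a nonzero row in the left kernel would be a linear relation on [s]. *)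
Lemma lin_indep_size_le B s t : lin_indep B -> uniq s -> [set` s] `<=` B ->
  uniq t -> (forall v, v \in s -> lin_span [set` t] v) -> (size s <= size t)%N.
Proof.
move=> indB s_uniq sB t_uniq s_t.
have coord v : exists c : V -> K, v \in s -> v = \sum_(u <- t) c u *: u.
  have [sv|] := boolP (v \in s); last by exists (fun=> 0).
  have [r [c [rt ->]]] := s_t v sv.
  by have [c' e] := lin_comb_subseq c t_uniq rt; exists c'.
have [a aP] := choice coord.
pose M : 'M[K]_(size s, size t) := \matrix_(i, j) a s`_i t`_j.
rewrite leqNgt; apply/negP => lt_ts.
have kerM : kermx M != 0.
  rewrite -mxrank_eq0 mxrank_ker subn_eq0 -ltnNge.
  exact: leq_ltn_trans (rank_leq_col _) lt_ts.
case/rowV0Pn: kerM => x /sub_kermxP xM0 /eqP x_neq0; apply: x_neq0.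
pose c v := if insub (index v s) is Some i then x 0 i else 0.
have cE (i : 'I_(size s)) : c s`_i = x 0 i.
  by rewrite /c index_uniq // valK.
apply/rowP => i; rewrite mxE -cE; apply: (indB s) => //; last exact: mem_nth.
rewrite (big_nth 0) big_mkord.
transitivity (\sum_(j < size t) (x *m M) 0 j *: t`_j); last first.
  by rewrite xM0 big1 // => j _; rewrite mxE scale0r.
under [RHS]eq_bigr do rewrite mxE scaler_suml.
rewrite exchange_big; apply: eq_bigr => j _ /=.
rewrite cE {1}(aP s`_j) ?mem_nth // (big_nth 0) big_mkord scaler_sumr.
by apply: eq_bigr => h _; rewrite mxE scalerA.
Qed.

(** [dimK] picks the size of some finite basis; the preceding bound, applied both ways, shows that
    the choice is immaterial. *)
Lemma dimK_basis W t : uniq t -> is_basis W [set` t] -> dimK W = size t.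
Proof.
move=> t_uniq basis_t; apply: xget_unique.
  exists [set` t]; split=> //.
  rewrite (_ : [set` t] = [set` [fset v in t]%fset]); last first.
    by apply/seteqP; split=> v /=; rewrite inE.
  by apply/card_eq_fsetP; rewrite card_fseq undup_id.
move=> d [B [[BW indB WB] cardB]].
have /finite_fsetP[X defB] : finite_set B by apply/finite_setP; exists d.
have sizeX : size (enum_fset X) = d.
  by apply/card_eq_fsetP; rewrite -defB.
case: basis_t => tW indt Wt; rewrite -sizeX; apply/eqP; rewrite eqn_leq.
have memX v : v \in enum_fset X = (v \in X) by [].
apply/andP; split.
  apply: (lin_indep_size_le indB) => //; first exact: fset_uniq.
  - by rewrite defB.
  - by move=> v Xv; apply/Wt/BW; rewrite defB.
apply: (lin_indep_size_le indt) => //; first exact: fset_uniq.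
by move=> v tv; suff : lin_span B v by [rewrite defB]; exact/WB/tW.
Qed.

(** The injective [g] maps a row base of [A] to a basis. This links the set-theoretic [dimK] to
    [\rank]. *)
Lemma dimK_linear_image n p (g : {linear 'rV[K]_p -> V}) (A : 'M[K]_(n, p)) :
  injective g -> dimK [set g (u *m A) | u in [set: 'rV[K]_n]] = \rank A.
Proof.
move=> g_inj; pose X := row_base A; pose b i := g (row i X).
have b_inj : injective b.
  move=> i j /g_inj; rewrite !rowE => /(row_free_inj (row_base_free A)).
  move/rowP/(_ j); rewrite !mxE !eqxx /=; case: eqVneq => // _ /esym/eqP.
  by rewrite oner_eq0.
pose t := [seq b i | i : 'I_(\rank A)].
have t_uniq : uniq t by rewrite map_inj_uniq ?enum_uniq.
rewrite (dimK_basis t_uniq); first by rewrite size_map -cardE card_ord.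
have sum_t (a : V -> K) : \sum_(v <- t) a v *: v = g ((\row_i a (b i)) *m X).
  rewrite big_map big_enum /= mulmx_sum_row linear_sum; apply: eq_bigr => i _.
  by rewrite linearZ mxE.
split.
- move=> _ /mapP[i _ ->].
  have /submxP[D eD] : (row i X <= A)%MS by rewrite -(eq_row_base A) row_sub.
  by exists D => //; rewrite /b eD.
- move=> s c s_uniq st sum0 v sv.
  have := sum_t (fun v => if v \in s then c v else 0).
  have -> : \sum_(v <- t) (if v \in s then c v else 0) *: v = 0.
    rewrite -[RHS]sum0.
    under eq_bigr do rewrite (fun_if (fun a => a *: _)) scale0r.
    rewrite -big_mkcond -big_filter; apply: perm_big; apply: uniq_perm => //.
      exact: filter_uniq.
    by move=> u; rewrite mem_filter andb_idr // => /st.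
  rewrite -[0](linear0 g) => /g_inj/esym.
  rewrite -(mul0mx _ X) => /(row_free_inj (row_base_free A)) a0.
  have /mapP[i _ vi] := st v sv.
  by have := congr1 (fun a : 'rV_ _ => a 0 i) a0; rewrite !mxE -vi sv.
- move=> _ [u _ <-].
  have /submxP[D ->] : (u *m A <= X)%MS by rewrite eq_row_base submxMl.
  (* Coefficients are indexed by vectors; as [b] is injective, the sum at [b i] is just [D 0 i]. *)
  exists t, (fun v => \sum_(i | b i == v) D 0 i); split=> //.
  rewrite sum_t; congr (g (_ *m _)); apply/rowP => i; rewrite mxE.
  by rewrite (eq_bigl (pred1 i)) ?big_pred1_eq // => j; rewrite (inj_eq b_inj).
Qed.

End Dimension.

(** * Modules from matrix representations *)

(** The alias mentions [rho] so that the action through [rho] can be attached to the type of column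
    vectors. *)
Definition repmod (K : fieldType) (R : algType K) d
  (rho : {lrmorphism R -> 'M[K]_d.+1}) : Type := 'cV[K]_d.+1.

Section RepresentationModule.
Variables (Rl : realType) (K : fieldType) (R : algType K) (d : nat).
Variable rho : {lrmorphism R -> 'M[K]_d.+1}.
Local Notation M := (repmod rho).

HB.instance Definition _ := GRing.Zmodule.on M.

Let scale (a : R) (x : M) : M := rho a *m (x : 'cV_d.+1).
Let scaleA a b x : scale a (scale b x) = scale (a * b) x.
Proof. by rewrite /scale rmorphM mulmxA. Qed.
Let scale1 : left_id 1 scale.
Proof. by move=> x; rewrite /scale rmorph1 mul1mx. Qed.
Let scaleDr : right_distributive scale +%R.
Proof. by move=> a x y; apply: mulmxDr. Qed.
Let scaleDl x : {morph scale^~ x : a b / a + b}.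
Proof. by move=> a b; rewrite /scale rmorphD mulmxDl. Qed.
HB.instance Definition _ := GRing.Zmodule_isLmodule.Build R M
  scaleA scale1 scaleDr scaleDl.

Local Notation MK := (restrict_scalars M).

Lemma repmod_scalarE (c : K) (x : MK) :
  c *: x = (c *: (x : 'cV[K]_d.+1)) :> 'cV_d.+1.
Proof.
have -> : c *: x = rho (c *: 1) *m (x : 'cV[K]_d.+1) by [].
by rewrite linearZ rmorph1 /= -scalemxAl mul1mx.
Qed.

Let tr (u : 'rV[K]_d.+1) : MK := u^T.
Let tr_linear : linear tr.
Proof. by move=> c u v; rewrite /tr linearP repmod_scalarE. Qed.
HB.instance Definition _ :=
  GRing.isLinear.Build K 'rV[K]_d.+1 MK *:%R tr tr_linear.

Lemma dimK_repmod : dimK [set: MK] = d.+1.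
Proof.
have tr_inj : injective tr by exact: trmx_inj.
rewrite -[RHS](mxrank1 K) -(dimK_linear_image _ tr_inj); congr dimK.
apply/seteqP; split=> // x _; exists (x^T) => //.
by rewrite mulmx1; exact: trmxK.
Qed.

Section Range.
Variables (k l : nat) (A : 'M[R]_(k, l)).

(** Identifies long row vectors, to which [dimK_linear_image] applies, with tuples of module
    elements, which are columns. *)
Let cut n (u : 'rV[K]_(\sum_(i < n) d.+1)) : {ffun 'I_n -> MK} :=
  [ffun i => (submxrow u i)^T : MK].
Let cut_linear n : linear (@cut n).
Proof.
move=> c u v; apply/ffunP => i; rewrite !ffunE -[RHS]tr_linear; congr tr.
by apply/rowP => s; rewrite !mxE.
Qed.
HB.instance Definition _ n :=
  GRing.isLinear.Build K _ {ffun 'I_n -> MK} *:%R (@cut n) (@cut_linear n).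

Let cut_inj n : injective (@cut n).
Proof.
move=> u v /ffunP euv; rewrite -(submxrowK u) -(submxrowK v).
by apply: eq_mxrow => i; apply: trmx_inj; have := euv i; rewrite !ffunE.
Qed.

Let cut_surj n (x : {ffun 'I_n -> MK}) : x = cut (\mxrow_i (x i : 'cV_d.+1)^T).
Proof. by apply/ffunP => i; rewrite ffunE mxrowK trmxK. Qed.

(** Through [cut], [mulmod A] becomes right multiplication by the transposed block matrix, so its
    range is the image of a row space. *)
Lemma dimK_range_mulmod :
  dimK (range (mulmod A : {ffun 'I_l -> M} -> {ffun 'I_k -> MK}))
    = \rank (\mxblock_(i, j) rho (A i j)).
Proof.
rewrite -mxrank_tr -(dimK_linear_image _ (@cut_inj k)); congr dimK.
have mulE u : mulmod A (cut u) = cut (u *m (\mxblock_(i, j) rho (A i j))^T).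
  apply/ffunP => i; rewrite !ffunE -{2}(submxrowK u) tr_mxblock.
  rewrite mul_mxrow_mxblock mxrowK raddf_sum; apply: eq_bigr => j _ /=.
  by rewrite ffunE trmx_mul trmxK.
apply/seteqP; split=> [_ [x _ <-]|_ [u _ <-]].
  by rewrite (cut_surj x) mulE; eexists.
by exists (cut u); rewrite ?mulE.
Qed.

Lemma rk_mod_repmod :
  rk_mod Rl M A = blockrk Rl (fun i j => rho (A i j)).
Proof. by rewrite /rk_mod dimK_range_mulmod dimK_repmod. Qed.

End Range.

Lemma repmod_finitely_generated : finitely_generated M.
Proof.
exists d.+1, (fun i => delta_mx i 0 : 'cV_d.+1) => x.
exists (fun i => ((x : 'cV[K]_d.+1) i 0)%:A).
rewrite [LHS](matrix_sum_delta (x : 'cV[K]_d.+1)); apply: eq_bigr => i _.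
by rewrite big_ord1; exact: esym (repmod_scalarE _ _).
Qed.

(** The Sylvester axioms come from pulling back the block rank along [rho]; [rk_mod_repmod]
    identifies this pullback with the rank function of the module. *)
Lemma repmod_in_Fin : exists r : sylvester Rl R,
  Fin r /\ forall k l (A : 'M[R]_(k, l)),
    r k l A = blockrk Rl (fun i j => rho (A i j)).
Proof.
have [rM rME] := blockrk_sylvester Rl K d.
have [r rE] := sylvester_comap rho rM.
have {}rE k l (A : 'M[R]_(k, l)) :
    r k l A = blockrk Rl (fun i j => rho (A i j)).
  by rewrite rE rME; apply: eq_blockrk => i j; rewrite mxE.
exists r; split=> //.
exists M; split=> [||k l A]; last by rewrite rE rk_mod_repmod.
  exists (const_mx 1 : 'cV_d.+1); apply/eqP => /matrixP/(_ 0 0)/eqP.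
  by rewrite !mxE oner_eq0.
exact: repmod_finitely_generated.
Qed.

End RepresentationModule.

(** * Approximate representations *)

(** Intersecting with one more left kernel lowers the dimension by at most [\rank (D i)]. *)
Lemma common_kernel (K : fieldType) (I : finType) n (D : I -> 'M[K]_n) :
  exists2 C : 'M[K]_n, (forall i, C *m D i = 0) &
    (n <= \rank C + \sum_i \rank (D i))%N.
Proof.
exists (\bigcap_i kermx (D i))%MS.
  by move=> i; apply/sub_kermxP; rewrite (bigcapmx_inf i).
elim/big_rec2: _ => [|i C r _ IH]; first by rewrite mxrank1 addn0.
have := mxrank_sum_cap (kermx (D i)) C; rewrite mxrank_ker.
have := rank_leq_col (kermx (D i) + C)%MS; have := rank_leq_row (D i).
set a := \rank (D i); set b := \rank (_ :&: _)%MS; set c := \rank (_ + _)%MS.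
move: IH; move: (\rank C) => d; lia.
Qed.

Section Stabilize.
Variables (K : fieldType) (m : nat) (R : falgType K).
Variable psi : {linear R -> 'M[K]_m.+1}.
Local Notation e := (vbasis (fullv : {vspace R})).
Local Notation I := 'I_(\dim (fullv : {vspace R})).

Definition defect (r s : R) : 'M[K]_m.+1 := psi r * psi s - psi (r * s).

(* The index None stands for the failure of psi to preserve the unit. *)
Definition basis_defect (x : option (I * I)) :=
  if x is Some ij then defect e`_(ij.1) e`_(ij.2) else psi 1 - 1.

(** The defect is bilinear, so rows that kill it on pairs of basis elements kill it on all pairs. *)
Lemma defect_span (C : 'M[K]_m.+1) :
  (forall i j : I, C *m (defect e`_i e`_j)^T = 0) ->
  forall r s, C *m (psi s)^T *m (psi r)^T = C *m (psi (r * s))^T.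
Proof.
move=> C0 r s; rewrite -mulmxA -trmx_mul.
rewrite (coord_vbasis (memvf r)) (coord_vbasis (memvf s)).
set a := fun i => coord e i r; set b := fun i => coord e i s.
have -> : psi (\sum_i a i *: e`_i) *m psi (\sum_i b i *: e`_i) =
    \sum_i \sum_j (a i * b j) *: (psi e`_i *m psi e`_j).
  rewrite !(linear_sum psi) mulmx_suml; apply: eq_bigr => i _.
  rewrite mulmx_sumr; apply: eq_bigr => j _.
  by rewrite !linearZ /= -scalemxAl scalerA mulrC.
have -> : psi ((\sum_i a i *: e`_i) * (\sum_i b i *: e`_i)) =
    \sum_i \sum_j (a i * b j) *: psi (e`_i * e`_j).
  rewrite mulr_suml (linear_sum psi); apply: eq_bigr => i _.
  rewrite mulr_sumr (linear_sum psi); apply: eq_bigr => j _.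
  by rewrite -scalerAl -scalerAr scalerA linearZ.
set D := (fun i j : I => (a i * b j) *: (defect e`_i e`_j)^T).
have -> : (\sum_i \sum_j (a i * b j) *: (psi e`_i *m psi e`_j))^T =
    (\sum_i \sum_j (a i * b j) *: psi (e`_i * e`_j))^T + \sum_i \sum_j D i j.
  apply/matrixP => x y; rewrite !mxE !summxE -big_split; apply: eq_bigr => i _.
  rewrite !summxE -big_split; apply: eq_bigr => j _ /=.
  by rewrite !mxE -mulrDr subrKC.
rewrite mulmxDr mulmx_sumr [X in _ + X]big1 ?addr0 // => i _.
by rewrite mulmx_sumr big1 // => j _; rewrite -scalemxAr C0 scaler0.
Qed.

(* Subspaces are row spaces in MathComp, so psi acts on them through transposes
   and Z plays the role of psi(R) W. *)
Lemma stable_subspace :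
  let delta := (\sum_x \rank (basis_defect x))%N in
  exists Z : 'M[K]_m.+1,
  [/\ (m.+1 <= \rank Z + delta)%N,
     forall r, (Z *m (psi r)^T <= Z)%MS,
     forall r s, Z *m (psi s)^T *m (psi r)^T = Z *m (psi (r * s))^T &
     Z *m (psi 1)^T = Z].
Proof.
move=> delta; have [C C0 le_mC] := common_kernel (fun x => (basis_defect x)^T).
have Cmul := defect_span (fun i j => C0 (Some (i, j))).
have C1 : C *m (psi 1)^T = C.
  have -> : (psi 1)^T = (psi 1 - 1)^T + 1%:M.
    by apply/matrixP => i j; rewrite !mxE eq_sym subrK.
  by rewrite mulmxDr (C0 None) add0r mulmx1.
(* With W the row space of [C], this is psi(R) W; by linearity the basis of [R] suffices. *)
pose Z := (\sum_(i : I) <<C *m (psi e`_i)^T>>)%MS.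
have CZ r : (C *m (psi r)^T <= Z)%MS.
  rewrite (coord_vbasis (memvf r)) (linear_sum psi).
  rewrite [X in (_ *m X <= _)%MS](_ : _ = \sum_i coord e i r *: (psi e`_i)^T).
    rewrite mulmx_sumr summx_sub // => i _.
    by rewrite -scalemxAr scalemx_sub // (sumsmx_sup i) // genmxE.
  apply/matrixP => x y; rewrite mxE !summxE; apply: eq_bigr => i _.
  by rewrite linearZ !mxE.
have ZP n (A B : 'M[K]_(m.+1, n)) :
    (forall i : I, C *m (psi e`_i)^T *m A = C *m (psi e`_i)^T *m B) ->
    Z *m A = Z *m B.
  move=> AB; apply/eqP; rewrite -subr_eq0 -mulmxBr; apply/eqP/sub_kermxP.
  apply/sumsmx_subP => i _; rewrite genmxE; apply/sub_kermxP.
  by rewrite mulmxBr AB subrr.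
exists Z; split.
(* By [C1] the rows of [C] lie in [Z], so the bound on the codimension carries over. *)
- apply: leq_trans le_mC _; under eq_bigr do rewrite mxrank_tr.
  by rewrite leq_add2r mxrankS // -C1.
- move=> r; rewrite sumsmxMr_gen; apply/sumsmx_subP => i _.
  rewrite genmxE (eqmxMr _ (genmxE _)) Cmul; exact: CZ.
- move=> r s; rewrite -mulmxA; apply: ZP => i.
  by rewrite mulmxA Cmul Cmul Cmul mulrA.
- rewrite -[RHS]mulmx1; apply: ZP => i; by rewrite Cmul mul1r mulmx1.
Qed.

End Stabilize.

(** * Ranks after restriction to an invariant subspace *)

Section ScalarBlocks.
Variable K : fieldType.

(** The Kronecker product of the identity of size [n] with [X], written as a block matrix so that
    [mul_mxblock] computes its products. *)
Definition diagblocks n p q (X : 'M[K]_(p, q)) :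
    'M[K]_(\sum_(i < n) p, \sum_(j < n) q) :=
  \mxblock_(i < n, j < n) ((i == j)%:R *: X).

Lemma mul_diagblocks_mxblock n l p q r (X : 'M[K]_(p, q))
    (G : 'I_n -> 'I_l -> 'M[K]_(q, r)) :
  diagblocks n X *m \mxblock_(i, j) G i j = \mxblock_(i, j) (X *m G i j).
Proof.
rewrite /diagblocks mul_mxblock; apply: eq_mxblock => i j.
rewrite (bigD1 i) //= eqxx scale1r big1 ?addr0 // => h /negbTE.
by rewrite eq_sym => ->; rewrite scale0r mul0mx.
Qed.

Lemma mul_mxblock_diagblocks n l p q r (X : 'M[K]_(p, q))
    (G : 'I_l -> 'I_n -> 'M[K]_(r, p)) :
  \mxblock_(i, j) G i j *m diagblocks n X = \mxblock_(i, j) (G i j *m X).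
Proof.
rewrite /diagblocks mul_mxblock; apply: eq_mxblock => i j.
rewrite (bigD1 j) //= eqxx scale1r big1 ?addr0 // => h /negbTE ->.
by rewrite scale0r mulmx0.
Qed.

Lemma diagblocks1 n p : diagblocks n (1%:M : 'M[K]_p) = 1%:M.
Proof.
rewrite -(mxdiagZ (p_ := fun=> p) 1) /mxdiag; apply: eq_mxblock => i j.
by case: eqP => _; rewrite ?scale1r ?scale0r ?conform_mx_id.
Qed.

Lemma diagblocks_free n p q (X : 'M[K]_(p, q)) :
  row_free X -> row_free (diagblocks n X).
Proof.
move=> freeX; apply/row_freeP; exists (diagblocks n (pinvmx X)).
by rewrite mul_diagblocks_mxblock -diagblocks1; apply: eq_mxblock => i j;
  rewrite -scalemxAr mulmxVp.
Qed.

(* The rows of X span a subspace on which all G i j restrict to H i j. *)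
Lemma rank_mxblock_restrict k l d m (X : 'M[K]_(d, m))
    (G : 'I_k -> 'I_l -> 'M[K]_m) (H : 'I_k -> 'I_l -> 'M[K]_d) :
  row_free X -> (forall i j, X *m G i j = H i j *m X) ->
  (\rank (\mxblock_(i, j) H i j) <= \rank (\mxblock_(i, j) G i j)
    <= \rank (\mxblock_(i, j) H i j) + k * (m - d))%N.
Proof.
move=> freeX XG.
(* By the Sylvester rank inequality, multiplying by [diagblocks k X], of rank [k * d] in dimension
   [k * m], loses at most [k * (m - d)]. *)
have := mxrank_mul_min (diagblocks k X) (\mxblock_(i, j) G i j).
have := mxrankM_maxr (diagblocks k X) (\mxblock_(i, j) G i j).
rewrite mul_diagblocks_mxblock (eq_mxblock XG) -mul_mxblock_diagblocks.
rewrite mxrankMfree ?diagblocks_free // (eqP (diagblocks_free k freeX)).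
move: (\rank _) (\rank _) => h g; rewrite !sum_nat_const card_ord mulnBr.
by move=> -> /=; lia.
Qed.

End ScalarBlocks.

(** Put [q = a / d], which lies between 0 and [l]. Then [q * m - b] is at most [q * (m - d)] and at
    least [(q - l) * (m - d)], while [m - d <= e]. *)
Lemma ratio_dist (F : realFieldType) (a b d m l e : nat) :
  (0 < d <= m)%N -> (m <= d + e)%N -> (a <= l * d)%N ->
  (a <= b <= a + l * (m - d))%N ->
  `|a%:R / d%:R - b%:R / m%:R| <= l%:R * (e%:R / m%:R) :> F.
Proof.
move=> /andP[d_gt0 le_dm] le_me le_a /andP[le_ab le_ba].
have d0 : 0 < d%:R :> F by rewrite ltr0n.
have m0 : 0 < m%:R :> F by rewrite ltr0n; lia.
have le_de : l%:R * (m%:R - d%:R) <= l%:R * e%:R :> F.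
  by rewrite -natrB // -!natrM ler_nat leq_mul2l; lia.
have {}le_ba : b%:R <= a%:R + l%:R * (m%:R - d%:R) :> F.
  by rewrite -natrB // -natrM -natrD ler_nat.
have {}le_ab : a%:R <= b%:R :> F by rewrite ler_nat.
have {}le_dm : d%:R <= m%:R :> F by rewrite ler_nat.
have {}le_a : a%:R / d%:R <= l%:R :> F by rewrite ler_pdivrMr // -natrM ler_nat.
have a0 : 0 <= a%:R / d%:R :> F by rewrite divr_ge0 ?ler0n.
have aE : a%:R = a%:R / d%:R * d%:R :> F by rewrite divfK // gt_eqF.
have bE : b%:R / m%:R * m%:R = b%:R :> F by rewrite divfK // gt_eqF.
rewrite mulrA -(ler_pM2r m0) divfK ?gt_eqF // -{2}(gtr0_norm m0) -normrM.
rewrite mulrBl bE ler_norml; rewrite {}aE in le_ba le_ab.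
move: (a%:R / d%:R) le_a a0 le_ba le_ab => q le_q q0 le_ba le_ab.
have := mulr_ge0 q0 (_ : 0 <= m%:R - d%:R); rewrite subr_ge0 => /(_ le_dm) ?.
have := @mulr_ge0 _ (l%:R - q) (m%:R - d%:R).
rewrite !subr_ge0 => /(_ le_q le_dm) ?.
by apply/andP; split; lra.
Qed.

Section AlmostRepresentation.
Variables (Rl : realType) (K : fieldType) (m : nat) (R : falgType K).
Variable psi : {linear R -> 'M[K]_m.+1}.
Let delta := (\sum_x \rank (basis_defect psi x))%N.

(** The bound on [delta] makes the stable subspace nonzero, as the size [d.+1] demands; in
    coordinates of a row base [X], the restriction of [psi] to it is a true homomorphism. *)
Lemma almost_rep_restrict : (delta < m.+1)%N ->
  exists d (X : 'M[K]_(d.+1, m.+1)) (rho : {lrmorphism R -> 'M[K]_d.+1}),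
  [/\ row_free X, (m.+1 <= d.+1 + delta)%N &
      forall r, X *m (psi r)^T = (rho r)^T *m X].
Proof.
move=> lt_delta; have [Z [le_m Zstable Zmul Z1]] := stable_subspace psi.
have [d rkZ] : exists d, \rank Z = d.+1.
  by exists (\rank Z).-1; rewrite prednK //; rewrite -/delta in le_m; lia.
have [X [freeX XZ]] : exists X : 'M[K]_(d.+1, m.+1),
    row_free X /\ (X :=: Z)%MS.
  rewrite -rkZ; exists (row_base Z).
  by split; [apply: row_base_free | apply: eq_row_base].
have [L XE] : exists L, X = L *m Z by apply/submxP; rewrite XZ.
have Xmul r s : X *m (psi s)^T *m (psi r)^T = X *m (psi (r * s))^T.
  by rewrite XE -!mulmxA -(Zmul r s) !mulmxA.
(* The transpose turns the action on rows from the right into a homomorphism that keeps the order of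
   products. *)
pose rho r := (X *m (psi r)^T *m pinvmx X)^T.
have rhoX r : X *m (psi r)^T = (rho r)^T *m X.
  rewrite trmxK mulmxKpV // XZ (eqmxMr _ XZ); exact: Zstable.
have inj_tr (A B : 'M[K]_d.+1) : A^T *m X = B^T *m X -> A = B.
  by move/(row_free_inj freeX)/trmx_inj.
have rho_linear : linear rho.
  move=> c r s; rewrite /rho (_ : (psi _)^T = c *: (psi r)^T + (psi s)^T).
    rewrite mulmxDr mulmxDl -scalemxAr -scalemxAl.
    by apply/matrixP => i j; rewrite !mxE.
  by apply/matrixP => i j; rewrite linearP !mxE.
have rho_monoid : monoid_morphism rho.
  split=> [|r s]; apply: inj_tr; rewrite -rhoX.
    by rewrite XE -mulmxA Z1 trmx1 mul1mx.
  by rewrite -Xmul rhoX -mulmxA rhoX mulmxA -trmx_mul.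
pose rhoL : {lrmorphism R -> 'M[K]_d.+1} := HB.pack rho
  (GRing.isLinear.Build _ _ _ _ rho rho_linear)
  (GRing.isMonoidMorphism.Build _ _ rho rho_monoid).
exists d, X, rhoL; split=> //; first by rewrite -rkZ.
Qed.

(** One module serves all matrices [A]. The factor [l] is the number of block rows once everything
    is transposed. *)
Lemma almost_rep_close_to_Fin : (delta < m.+1)%N ->
  exists r : sylvester Rl R, Fin r /\
  forall k l (A : 'M[R]_(k, l)),
    `|r k l A - blockrk Rl (fun i j => psi (A i j))|
      <= l%:R * (delta%:R / m.+1%:R).
Proof.
case/almost_rep_restrict => d [X [rho [freeX le_m XE]]].
have [r [Fin_r rE]] := repmod_in_Fin Rl rho; exists r; split=> // k l A.
have le_dm : (d.+1 <= m.+1)%N by rewrite -(eqP freeX) rank_leq_col.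
rewrite rE /blockrk.
have := rank_mxblock_restrict (G := fun j i => (psi (A i j))^T)
  (H := fun j i => (rho (A i j))^T) freeX (fun j i => XE (A i j)).
rewrite -!tr_mxblock !mxrank_tr => le_ab.
apply: ratio_dist => //; apply: leq_trans (rank_leq_col _) _.
by rewrite sum_nat_const card_ord.
Qed.

End AlmostRepresentation.

(** * Closure of the finite rank functions *)

(** A neighbourhood of [r] contains the preimage of an open set of the product, which pointwise
    convergence reaches along [w]; sets in a filter are nonempty, so some [s n] lies there and in
    [E]. *)
Lemma closure_sylvester (Rl : realType) (S : nzRingType) (w : free_ultrafilter)
    (E : set (sylvester Rl S)) (r : sylvester Rl S)
    (s : nat -> sylvester Rl S) :
  (forall k l (A : 'M[S]_(k, l)), s n k l A @[n --> fultra w] --> r k l A) ->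
  (\forall n \near fultra w, E (s n)) -> closure E r.
Proof.
move=> sr Es B [_ [ [V openV <-] Vr] VB].
have : \forall n \near fultra w, V (syl_ptws (s n)).
  suff : {ptws, (syl_ptws (s n) @[n --> fultra w]) --> syl_ptws r}.
    by apply; exact: open_nbhs_nbhs.
  (* The product topology is the supremum of those induced by the evaluations; [cvg_image] asks that
     each evaluation be surjective. *)
  apply/cvg_sup => A; apply/cvg_image.
    by rewrite eqEsubset; split=> v // _; exists (cst v).
  move=> W /(sr _ _ (projT2 A)) sW; exists (@^~ A @^-1` W) => //.
  by rewrite eqEsubset; split => [j [? + <-]//|j Wj]; exists (fun=> j).
move=> On; have [n [En On']] := filter_ex (filterI Es On).
by exists (s n); split=> //; apply: VB.
Qed.

Section Lift.
Variables (Rl : realType) (K : fieldType) (m : nat -> nat).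
Variables (w : free_ultrafilter) (R : falgType K).
Variable psi : {linear R -> matU Rl K m w}.

(** Only the basis is lifted, and the lift is extended linearly: every [Psi n] is exactly linear,
    and only products and the unit may fail. *)
Lemma linear_lift : exists Psi : forall n, {linear R -> 'M[K]_((m n).+1)},
  forall r, matU_pi Rl w ((fun n => Psi n r) : prodmx K m) = psi r.
Proof.
pose e := vbasis (fullv : {vspace R}).
pose F n r : 'M[K]_((m n).+1) := \sum_i coord e i r *: matU_repr (psi e`_i) n.
have F_linear n : linear (F n).
  move=> c r s; rewrite /F scaler_sumr -big_split; apply: eq_bigr => i _ /=.
  by rewrite linearP scalerDl scalerA.
pose Psi n : {linear R -> 'M[K]_((m n).+1)} := HB.pack (F n)
  (GRing.isLinear.Build _ _ _ _ (F n) (F_linear n)).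
exists Psi => r.
rewrite [in RHS](coord_vbasis (memvf r)) linear_sum.
transitivity (matU_pi Rl w (\sum_i coord e i r *: matU_repr (psi e`_i))).
  by congr matU_pi; apply: prodmxP => n; rewrite prodmx_sumE.
rewrite matU_pi_sum; apply: eq_bigr => i _.
by rewrite matU_piZ matU_reprK linearZ.
Qed.

End Lift.

Lemma closure_Fin_of_lrmorphism (Rl : realType) (K : fieldType)
    (m : nat -> nat) (w : free_ultrafilter) (R : falgType K)
    (psi : {lrmorphism R -> matU Rl K m w}) (r : sylvester Rl R) :
  (forall k l (B : 'M[R]_(k, l)), r k l B = rk_matU (map_mx psi B)) ->
  closure (@Fin Rl K R) r.
Proof.
move=> rE; have [Psi PsiE] := linear_lift psi.
pose delta n := (\sum_x \rank (basis_defect (Psi n) x))%N.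
have delta0 : (delta n)%:R / (m n).+1%:R @[n --> fultra w] --> (0 : Rl).
  rewrite (_ : (fun n => _) = fun n => \sum_x
      (\rank (basis_defect (Psi n) x))%:R / (m n).+1%:R); last first.
    by apply/funext => n; rewrite /delta natr_sum mulr_suml.
  have sum0 : \sum_(x : option ('I_(\dim (fullv : {vspace R})) *
    'I_(\dim (fullv : {vspace R})))) (0 : Rl) = 0 by rewrite big1.
  rewrite -[X in _ --> X]sum0.
  apply: (@cvg_sumr _ _ _ _ (fun x n =>
    (\rank (basis_defect (Psi n) x))%:R / (m n).+1%:R) (fun=> 0)) => -[ [i j]|].
    pose e : seq R := vbasis (fullv : {vspace R}).
    (* As [psi] is multiplicative, the sequence of defects represents zero in the ultraproduct,
       hence lies in the ideal. *)
    apply: (@rank_idealP Rl K m w (((fun n => Psi n e`_i) : prodmx K m) *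
      ((fun n => Psi n e`_j) : prodmx K m) -
      ((fun n => Psi n (e`_i * e`_j)) : prodmx K m))).1.
    by apply/matU_piP; rewrite matU_piM !PsiE rmorphM.
  apply: (@rank_idealP Rl K m w (((fun n => Psi n 1) : prodmx K m) - 1)).1.
  by apply/matU_piP; rewrite PsiE rmorph1 matU_pi1.
(* Where [delta n] is too large, [r] itself serves as a default value; [near_lt] shows that these
   [n] are negligible for [w]. *)
have ex_s n : exists s : sylvester Rl R, (delta n < (m n).+1)%N -> Fin s /\
    forall k l (A : 'M[R]_(k, l)),
    `|s k l A - blockrk Rl (fun i j => Psi n (A i j))|
      <= l%:R * ((delta n)%:R / (m n).+1%:R).
  have [lt_delta|?] := boolP (delta n < (m n).+1)%N; last by exists r.
  by have [s sP] := almost_rep_close_to_Fin Rl lt_delta; exists s.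
have [s sP] := choice ex_s.
have near_lt : \forall n \near fultra w, (delta n < (m n).+1)%N.
  near=> n; rewrite -(ltr_nat Rl) -[X in _ < X]mul1r -ltr_pdivrMr ?ltr0Sn //.
  near: n; exact: (cvgr_lt _ delta0).
apply: (@closure_sylvester _ _ w _ _ s); last first.
  by apply: filterS near_lt => n /sP[].
move=> k l A; pose b n := blockrk Rl (fun i j => Psi n (A i j)).
have bcvg : b n @[n --> fultra w] --> r k l A.
  rewrite rE; apply: (rk_matU_cvg (F := fun i j n => Psi n (A i j))) => i j.
  by rewrite PsiE mxE.
rewrite (_ : (fun n => _) = fun n => b n + (s n k l A - b n)); last first.
  by apply/funext => n; rewrite subrKC.
rewrite -[r k l A]addr0; apply: cvgD => //; apply/norm_cvg0P.
apply: (@squeeze_cvgr _ _ _ _ (fun=> 0)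
  (fun n => l%:R * ((delta n)%:R / (m n).+1%:R))).
- by apply: filterS near_lt => n /sP[_ dist]; rewrite normr_ge0 dist.
- exact: cvg_cst.
- by rewrite -[X in _ --> X](mulr0 l%:R); apply: cvgMr.
Unshelve. all: by end_near. Qed.

Theorem theorem3 (Rl : realType) (K : finFieldType) (A : algType K)
    (sofA : sofic Rl A) (m : nat -> nat) (w : free_ultrafilter)
    (phi : {lrmorphism A -> matU Rl K m w}) (phi_inj : injective phi)
    (R : falgType K) (rho : {lrmorphism R -> A}) :
  exists rk_rho : sylvester Rl R,
    [/\ forall k l (B : 'M[R]_(k, l)),
          rk_rho k l B = rk_sofic phi (map_mx rho B),
        rank_spectrum rk_rho &
        closure (@Fin Rl K R) rk_rho].
Proof.
pose psi : {lrmorphism R -> matU Rl K m w} := phi \o rho.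
have [rU rUE] := @rk_matU_sylvester Rl K m w.
have [r rE] := sylvester_comap psi rU.
have psiE k l (B : 'M[R]_(k, l)) : map_mx psi B = map_mx phi (map_mx rho B).
  by rewrite -map_mx_comp.
exists r; split=> [k l B||].
- by rewrite rE rUE /rk_sofic psiE.
(* The ultraproduct itself witnesses membership in the rank spectrum. *)
- exists (matU Rl K m w), rU, psi; split=> //; first exact: matU_regular.
  by move=> k l B; rewrite rUE; apply: rk_matU_eq0.
- by apply: closure_Fin_of_lrmorphism => k l B; rewrite rE rUE.
Qed.
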